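(* Let $n\ge 1$, let $V\subset\mathbb{R}^{n+1}$ be a compact convex set, and let $\mathscr{M}=\partial V$ be the corresponding closed compact $n$-dimensional convex surface. If the Steiner polynomial $S_V^{\mathbb{R}^{n+1}}$ is dissipative, then the Weyl polynomial $W_{\mathscr{M}}^{1}$ of index $1$ is conservative.
   Context: $B^m$ is the closed unit ball of $\mathbb{R}^m$. For a compact convex set $V\subset\mathbb{R}^m$, the Steiner polynomial $S_V^{\mathbb{R}^m}$ is the polynomial satisfying $S_V^{\mathbb{R}^m}(t)=\mathrm{Vol}_m(V+tB^m)$ for all real $t\ge 0$; it is considered for complex $t$. The Weyl polynomial of index $1$ of the surface $\partial V$, $V\subset\mathbb{R}^{n+1}$ compact convex (possibly non-smooth or with empty interior), is defined by $2t\,W^1_{\partial V}(t)=S_V^{\mathbb{R}^{n+1}}(t)-S_V^{\mathbb{R}^{n+1}}(-t)$. A polynomial is dissipative if all its roots lie in the open left half plane $\{z:\mathrm{Re}\,z<0\}$. A polynomial is conservative if all its roots are purely imaginary and simple. *)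

(* Defs.v *)
From HB Require Import structures.
From mathcomp Require Import all_boot all_order all_algebra.
From mathcomp Require Import all_classical all_reals all_analysis.
From mathcomp Require Import complex.

Set Implicit Arguments.
Unset Strict Implicit.
Unset Printing Implicit Defensive.

Import Order.TTheory GRing.Theory Num.Theory.
Import numFieldNormedType.Exports.

Local Open Scope classical_set_scope.
Local Open Scope ring_scope.

Section Volume.
Variables (R : realType) (m : nat).

Definition box (a b : 'rV[R]_m) : set 'rV[R]_m :=
  [set x | forall i, a 0 i <= x 0 i <= b 0 i].

(* If some b 0 i < a 0 i then [box a b] is empty and [box_vol a b] is 0. *)
Definition box_vol (a b : 'rV[R]_m) : R :=
  \prod_(i < m) Num.max 0 (b 0 i - a 0 i).

(* The m-dimensional Lebesgue outer measure, which on measurable sets, and in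
   particular on the compact sets to which it is applied below, is the
   m-dimensional volume. *)
Definition vol (A : set 'rV[R]_m) : \bar R :=
  ereal_inf [set (\sum_(0 <= k <oo) (box_vol (c k).1 (c k).2)%:E)%E
            | c in [set c : nat -> 'rV[R]_m * 'rV[R]_m |
                    A `<=` \bigcup_k box (c k).1 (c k).2]].

(* The norm that the library puts on 'rV[R]_m is the sup norm. *)
Definition euclidean_norm (x : 'rV[R]_m) : R :=
  Num.sqrt (\sum_(i < m) x 0 i ^+ 2).

Definition unit_ball : set 'rV[R]_m := [set x | euclidean_norm x <= 1].

Definition parallel_body (V : set 'rV[R]_m) (t : R) : set 'rV[R]_m :=
  [set x + t *: y | x in V & y in unit_ball].

End Volume.

Section Polynomials.
Variable R : realType.

(* [S] is determined by [V]: two polynomials that agree for all t >= 0 are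
   equal.  Its coefficients are real because its values at t >= 0 are. *)
Definition is_steiner_poly m (V : set 'rV[R]_m) (S : {poly R}) : Prop :=
  forall t : R, 0 <= t -> vol (parallel_body V t) = (S.[t])%:E.

(* The Weyl polynomial of index 1 of the surface bounding [V]. *)
Definition is_weyl_poly1 m (V : set 'rV[R]_m) (W : {poly R}) : Prop :=
  exists2 S : {poly R}, is_steiner_poly V S &
    forall t : R, 2 * t * W.[t] = S.[t] - S.[- t].

Definition complex_poly (P : {poly R}) : {poly R[i]} :=
  map_poly (real_complex R) P.

(* Every complex number is a root of the zero polynomial, which is therefore
   neither dissipative nor conservative; nonzero constants are both. *)
Definition dissipative (P : {poly R}) : Prop :=
  forall z : R[i], root (complex_poly P) z -> complex.Re z < 0.

Definition conservative (P : {poly R}) : Prop :=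
  forall z : R[i], root (complex_poly P) z ->
    complex.Re z = 0 /\ mup z (complex_poly P) = 1%N.

End Polynomials.

(* Main.v *)
(* A nonzero Steiner polynomial S is not constant: the bounded set V lies in
   1/2 (V + tB) for some t > 0, hence S(0) <= 2^-(n+1) S(t).  The rest is the
   Hermite-Biehler argument.  Let the roots a of S satisfy Re a < 0.  Since S is
   real, |S(-z)| is the product of the |z + conj a|, each smaller than |z - a| when
   Re z > 0, so S(z) = S(-z) is possible only on the imaginary axis.  There
   S'/S = sum_a 1/(z - a) has positive real part, so the zeros of S(z) - S(-z) are
   simple. *)
Require Import Defs.
From mathcomp Require Import all_boot all_order all_algebra.
From mathcomp Require Import all_classical all_reals all_analysis.
From mathcomp Require Import complex ring.

Import Order.TTheory GRing.Theory Num.Theory.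
Import numFieldNormedType.Exports.

Local Open Scope classical_set_scope.
Local Open Scope ring_scope.

(** The difference vanishes at as many naturals as its size, one more than the degree of a nonzero
    polynomial allows. *)
Lemma poly_eq_on_nonneg (R : numDomainType) (p q : {poly R}) :
  (forall t : R, 0 <= t -> p.[t] = q.[t]) -> p = q.
Proof.
move=> pq; apply/eqP; rewrite -subr_eq0; apply/eqP.
apply: (@roots_geq_poly_eq0 _ _ [seq k%:R | k <- iota 0 (size (p - q))]).
- apply/allP => _ /mapP[k _ ->].
  by rewrite rootE hornerD hornerN pq ?ler0n// subrr.
- rewrite map_inj_uniq ?iota_uniq// => i j /eqP.
  by rewrite eqr_nat => /eqP.
- by rewrite size_map size_iota.
Qed.

(** * Polynomials with all roots in the open left half plane *)

Section HermiteBiehler.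
Variable C : numClosedFieldType.
Implicit Types (x z a : C) (rs : seq C) (P : {poly C}).

(** The squares differ by [-4 Re z Re a]: the mirror image [- a^*] of [a] in the imaginary axis lies
    on the side of [z]. *)
Lemma ltr_norm_reflect z a :
  0 < 'Re z -> 'Re a < 0 -> `|z + a^*| < `|z - a|.
Proof.
move=> z0 a0; rewrite -(@ltr_pXn2r _ 2)// ?nnegrE//.
rewrite !normCK rmorphD rmorphB /= conjCK -subr_gt0.
have -> : (z - a) * (z^* - a^*) - (z + a^*) * (z^* + a) =
          4 * ('Re z * - 'Re a).
  by rewrite !ReE; field.
by rewrite mulr_gt0// mulr_gt0// oppr_gt0.
Qed.

Lemma conj_horner_real P x : map_poly Num.conj P = P -> (P.[x])^* = P.[x^*].
Proof. by move=> {2}<-; rewrite horner_map. Qed.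

Lemma stable_factor P : (1 < size P)%N -> (forall z, root P z -> 'Re z < 0) ->
  exists2 rs, P = lead_coef P *: \prod_(a <- rs) ('X - a%:P) &
    rs != [::] /\ forall a, a \in rs -> 'Re a < 0.
Proof.
move=> szP stP; have [rs PE] := closed_field_poly_normal P.
have lP0 : lead_coef P != 0.
  by rewrite lead_coef_eq0 -size_poly_eq0 -lt0n (leq_trans _ szP).
exists rs => //; split.
  apply: contraTneq szP => rs0; rewrite PE rs0 big_nil -leqNgt.
  by rewrite (leq_trans (size_scale_leq _ _))// size_poly1.
by move=> a ars; apply: stP; rewrite PE rootZ// root_prod_XsubC.
Qed.

Lemma stable_reflect_lt P z : map_poly Num.conj P = P -> (1 < size P)%N ->
  (forall x, root P x -> 'Re x < 0) -> 0 < 'Re z -> `|P.[- z]| < `|P.[z]|.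
Proof.
move=> Preal szP stP z0.
have [rs PE [rs0 rsN]] := stable_factor P szP stP.
rewrite -norm_conjC conj_horner_real// PE !hornerZ !normrM.
have lP0 : 0 < `|lead_coef P|.
  by rewrite normr_gt0 lead_coef_eq0 -size_poly_eq0 -lt0n (leq_trans _ szP).
(* Restricting to [a \in rs] makes the sign of [Re a] available factor by factor; the presence of at
   least one root gives strictness. *)
rewrite ltr_pM2l// !horner_prod !normr_prod big_seq_cond [ltRHS]big_seq_cond.
apply: ltr_prod => [|a /andP[ars _]].
  case: rs rs0 {PE rsN} => // a rs _ /=.
  by rewrite inE eqxx.
(* After conjugation the factor at [- z] is [- z^* - a], of modulus [|z + a^*|]. *)
rewrite normr_ge0 /= !hornerXsubC rmorphN /= -opprD normrN.
by rewrite -norm_conjC rmorphD /= conjCK ltr_norm_reflect// rsN.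
Qed.

(** The logarithmic derivative is the sum of the [1 / (x - a)], with real parts
    [Re (x - a) / |x - a|^2]. *)
Lemma log_deriv_prod_XsubC_Re_gt0 rs x : rs != [::] ->
  (forall a, a \in rs -> 'Re a < 'Re x) ->
  0 < 'Re ((\prod_(a <- rs) ('X - a%:P))^`().[x]
           / (\prod_(a <- rs) ('X - a%:P)).[x]).
Proof.
pose P s := \prod_(a <- s : seq C) ('X - a%:P); rewrite -/(P rs).
have step a s : 'Re a < 'Re x -> (P s).[x] != 0 ->
    'Re ((P (a :: s))^`().[x] / (P (a :: s)).[x]) =
    'Re (x - a) / `|x - a| ^+ 2 + 'Re ((P s)^`().[x] / (P s).[x]).
  move=> ax Px; rewrite /P big_cons -/(P s) derivM derivXsubC mul1r.
  rewrite hornerD !hornerM hornerXsubC -ReV -raddfD /=; congr ('Re _).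
  have xa : x - a != 0.
    by rewrite subr_eq0; apply: contraTneq ax => ->; rewrite ltxx.
  by field; rewrite Px.
have pos a : 'Re a < 'Re x -> 0 < 'Re (x - a) / `|x - a| ^+ 2.
  move=> ax; have re0 : 0 < 'Re (x - a) by rewrite raddfB /= subr_gt0.
  rewrite divr_gt0// exprn_gt0// normr_gt0.
  by apply: contraTneq re0 => ->; rewrite raddf0 ltxx.
have nz s : (forall a, a \in s -> 'Re a < 'Re x) -> (P s).[x] != 0.
  move=> sx; rewrite -/(root _ _) root_prod_XsubC.
  by apply/negP => /sx; rewrite ltxx.
(* The first root gives strict positivity; the tail, possibly empty, adds a nonnegative amount by
   induction. *)
move=> rs0 rsx; suff : 0 <= 'Re ((P (behead rs))^`().[x] / (P (behead rs)).[x]).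
  case: rs rs0 rsx => // a s _ rsx /= s0.
  have ax : 'Re a < 'Re x by rewrite rsx// mem_head.
  rewrite step// ?ltr_pwDl ?pos// nz// => b bs.
  by rewrite rsx// in_cons bs orbT.
have {rs0 rsx} : forall a, a \in behead rs -> 'Re a < 'Re x.
  by move=> a /mem_behead /rsx.
elim: (behead rs) => [|a s IH] sx.
  by rewrite /P big_nil derivC horner0 mul0r raddf0.
have sx' b : b \in s -> 'Re b < 'Re x by move=> bs; rewrite sx// in_cons bs orbT.
have ax : 'Re a < 'Re x by rewrite sx// mem_head.
by rewrite step// ?nz// addr_ge0 ?IH// ltW// pos.
Qed.

Lemma stable_log_deriv_gt0 P x : (1 < size P)%N ->
  (forall z, root P z -> 'Re z < 0) -> 0 <= 'Re x ->
  0 < 'Re (P^`().[x] / P.[x]).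
Proof.
move=> szP stP x0; have [rs PE [rs0 rsN]] := stable_factor P szP stP.
have lP0 : lead_coef P != 0.
  by rewrite lead_coef_eq0 -size_poly_eq0 -lt0n (leq_trans _ szP).
rewrite PE derivZ !hornerZ -mulf_div divff// mul1r.
apply: log_deriv_prod_XsubC_Re_gt0 => // a /rsN a0.
exact: lt_le_trans a0 x0.
Qed.

(** * Zeros of the odd part *)

Variables P W : {poly C}.
Hypothesis Preal : map_poly Num.conj P = P.
Hypothesis szP : (1 < size P)%N.
Hypothesis stP : forall z, root P z -> 'Re z < 0.
Hypothesis WE : 2%:P * 'X * W = P - (P \Po - 'X).

Lemma odd_part_horner z : 2 * z * W.[z] = P.[z] - P.[- z].
Proof.
have := congr1 (horner^~ z) WE.
by rewrite !hornerE horner_comp !hornerE.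
Qed.

(** At a root [P.[z] = P.[- z]], against the strict inequality of [stable_reflect_lt], taken at [z]
    if [Re z > 0] and at [- z] if [Re z < 0]. *)
Lemma odd_part_root_Re z : root W z -> 'Re z = 0.
Proof.
move=> /eqP Wz; have := odd_part_horner z; rewrite Wz mulr0 => /esym/eqP.
rewrite subr_eq0 => /eqP Pz.
have [||//] := real_ltgtP (Creal_Re z) (real0 C) => z0.
- have := @stable_reflect_lt P (- z) Preal szP stP.
  by rewrite opprK raddfN /= oppr_gt0 Pz ltxx => /(_ z0).
- by have := @stable_reflect_lt P z Preal szP stP z0; rewrite Pz ltxx.
Qed.

(* Where [P.[z] = P.[- z]], the derivative of [P(X) - P(-X)] divided by [P.[z]]
   is the sum of two logarithmic derivatives with positive real part. *)
Lemma odd_part_deriv_neq0 z : 'Re z = 0 -> P.[z] = P.[- z] ->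
  W.[z] + z * W^`().[z] != 0.
Proof.
move=> z0 Pz.
have := congr1 (fun Q => Q^`().[z]) WE.
rewrite derivB deriv_comp !derivM derivN derivX derivC.
rewrite !hornerE horner_comp !hornerE => E.
(* By [E], twice the quantity in question is [P'(z) + P'(- z)]: the inner derivative [-1] of
   [P(- X)] cancels the minus sign. *)
apply/eqP => Wz0; have {E Wz0} s0 : P^`().[z] + P^`().[- z] = 0.
  by rewrite -[RHS](mulr0 2) -Wz0 mulrDr mulrA E mulrN1 opprK.
have zN0 : 'Re (- z) = 0 by rewrite raddfN /= z0 oppr0.
have := addr_gt0 (@stable_log_deriv_gt0 P z szP stP _)
                 (@stable_log_deriv_gt0 P (- z) szP stP _).
rewrite z0 zN0 lexx => /(_ isT isT).
by rewrite -raddfD /= -Pz -mulrDl s0 mul0r raddf0 ltxx.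
Qed.

(** At a multiple root [W] and its derivative both vanish, hence so does [W + z W'], against
    [odd_part_deriv_neq0]. *)
Lemma odd_part_mup z : root W z -> mup z W = 1%N.
Proof.
move=> Wz; have z0 := odd_part_root_Re z Wz.
have Pz : P.[z] = P.[- z].
  by apply/eqP; rewrite -subr_eq0 -odd_part_horner (eqP Wz) mulr0.
have := odd_part_deriv_neq0 z z0 Pz => dW.
have W0 : W != 0.
  by apply: contraNneq dW => ->; rewrite deriv0 !horner0 mulr0 addr0.
apply/eqP; rewrite eqn_leq mup_leq// mup_geq// expr1 dvdp_XsubCl Wz andbT.
apply: contraNN dW => /dvdpP[Q ->].
rewrite expr2 !derivM derivXsubC !(hornerXsubC, hornerM, hornerD) subrr.
by rewrite !(mul0r, mulr0, addr0).
Qed.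

End HermiteBiehler.

(** * Volume under dilation and nonconstancy of the Steiner polynomial *)

Section Dilation.
Variables (R : realType) (m : nat).

Lemma box_vol_ge0 (a b : 'rV[R]_m) : 0 <= box_vol a b.
Proof. by apply: prodr_ge0 => i _; rewrite le_max lexx. Qed.

Lemma vol_ge0 (A : set 'rV[R]_m) : (0 <= vol A)%E.
Proof.
apply: le_ereal_inf_tmp => _ [c _ <-].
by apply: nneseries_ge0 => k _ _; rewrite lee_fin box_vol_ge0.
Qed.

Lemma box_volZ (s : R) (a b : 'rV[R]_m) : 0 <= s ->
  box_vol (s *: a) (s *: b) = s ^+ m * box_vol a b.
Proof.
move=> s0; rewrite /box_vol -[X in s ^+ X]card_ord -prodr_const -big_split /=.
by apply: eq_bigr => i _; rewrite !mxE -mulrBr maxr_pMr// mulr0.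
Qed.

(** Scaling by [s] turns each box cover of [A] into one of [B] and multiplies every box volume by
    [s ^+ m]. *)
Lemma vol_dilation_le (s : R) (A B : set 'rV[R]_m) : 0 < s ->
  B `<=` [set s *: x | x in A] -> (vol B <= (s ^+ m)%:E * vol A)%E.
Proof.
move=> s0 BA; have sm0 : 0 < s ^+ m by rewrite exprn_gt0.
rewrite -lee_pdivrMl//; apply: le_ereal_inf_tmp => _ [c Ac <-].
rewrite lee_pdivrMl//; apply: ereal_inf_lbound => /=.
exists (fun k => (s *: (c k).1, s *: (c k).2)) => /=.
  move=> _ /BA[x Ax <-]; have [k _ xk] := Ac _ Ax.
  by exists k => // i; rewrite !mxE !ler_pM2l//; exact: xk.
rewrite -nneseriesZl => [|k _]; last by rewrite lee_fin box_vol_ge0.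
by apply: eq_eseriesr => k _; rewrite box_volZ ?ltW.
Qed.

(** Each [v] is [1/2 (v + v)], and the second summand lies in [t B] once [t] bounds the Euclidean
    norm on [V]. *)
Lemma compact_sub_half_parallel_body (V : set 'rV[R]_m) : compact V ->
  exists2 t : R, 0 < t & V `<=` [set 2^-1 *: x | x in parallel_body V t].
Proof.
move=> /compact_bounded[M [_ VM]].
pose N := Num.max M 0 + 1.
have N0 : 0 < N by rewrite ltr_wpDl// le_max lexx orbT.
have MN : M < N by rewrite (@le_lt_trans _ _ (Num.max M 0)) ?le_max ?lexx ?ltrDl.
(* [N] bounds the sup norm on [V], so the squared Euclidean norm is at most
   [m N^2 <= ((m + 1) N)^2]; [m.+1] keeps the radius positive when [m = 0]. *)
exists (m.+1%:R * N); first by rewrite mulr_gt0.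
move=> v Vv; exists (v + v); last first.
  by rewrite -mulr2n -(scaler_nat _ v) scalerA mulVf ?scale1r.
have t0 : m.+1%:R * N != 0 by rewrite mulf_neq0// gt_eqF.
exists v => //; exists ((m.+1%:R * N)^-1 *: v); last first.
  by rewrite scalerA divff ?scale1r.
rewrite /unit_ball /= /euclidean_norm -[leRHS]sqrtr1 ler_wsqrtr//.
have coord i : v 0 i ^+ 2 <= N ^+ 2.
  rewrite -real_normK ?num_real// ler_pXn2r// ?nnegrE ?(ltW N0)//.
  apply: (@le_trans _ _ `|v|); last exact: VM N MN v Vv.
  rewrite [leRHS]/Num.Def.normr /= mx_normrE.
  by apply/bigmax_geP; right; exists (0, i).
have sumE : \sum_(i < m) ((m.+1%:R * N)^-1 *: v) 0 i ^+ 2 =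
            (m.+1%:R * N) ^- 2 * \sum_(i < m) v 0 i ^+ 2.
  by rewrite mulr_sumr; apply: eq_bigr => i _; rewrite mxE exprMn exprVn.
rewrite sumE ler_pdivrMl ?exprn_gt0 ?mulr_gt0// mulr1.
apply: le_trans (ler_sum _ (fun i _ => coord i)) _.
rewrite sumr_const card_ord -(mulr_natl (N ^+ 2)) exprMn ler_pM2r ?exprn_gt0//.
by rewrite -natrX ler_nat (leq_trans (leqnSn m))// expnS leq_pmulr.
Qed.

End Dilation.

(** If [S] is a constant [c], the inclusion in the half-size copy gives [0 <= c <= 2^-(n+1) c]; the
    factor is below 1 in positive dimension, so [c = 0]. *)
Lemma steiner_poly_size (R : realType) (n : nat) (V : set 'rV[R]_n.+1)
    (S : {poly R}) :
  compact V -> is_steiner_poly V S -> S != 0 -> (1 < size S)%N.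
Proof.
move=> cV SV S0; rewrite ltnNge; apply: contra S0 => /size1_polyC SC.
have [t t0 Vt] := compact_sub_half_parallel_body _ _ _ cV.
have V0 : parallel_body V 0 `<=` V.
  by move=> _ [v Vv [y _ <-]]; rewrite scale0r addr0.
have := vol_dilation_le _ _ 2^-1 _ _ _ (subset_trans V0 Vt).
rewrite invr_gt0 ltr0n => /(_ isT).
have := vol_ge0 _ _ (parallel_body V 0).
rewrite !SV ?(ltW t0)// SC !hornerC -EFinM !lee_fin => c0 cle.
have e1 : 2^-1 ^+ n.+1 < 1 :> R by rewrite exprn_ilt1// ?invf_lt1 ?ltr1n.
rewrite polyC_eq0 eq_le c0 andbT leNgt; apply/negP => cgt.
by have := le_lt_trans cle (_ : _ < S`_0); rewrite ltxx gtr_pMl// => /(_ e1).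
Qed.

Theorem theorem2p3 (R : realType) (n : nat) (V : set 'rV[R]_(n.+1))
    (S W : {poly R}) :
  (1 <= n)%N ->
  compact V -> convex_set V ->
  is_steiner_poly V S -> is_weyl_poly1 V W ->
  dissipative S -> conservative W.
Proof.
move=> _ cV _ SV [S' S'V WE'] dS.
(* The Weyl polynomial comes with its own Steiner polynomial [S'], which agrees with [S] for
   [t >= 0]. *)
have SS' : S' = S.
  apply: poly_eq_on_nonneg => t t0; apply: EFin_inj.
  by rewrite -S'V// SV.
(* As an identity of polynomials, the relation can be mapped to [R[i]]. *)
have {S'V} WE : 2%:P * 'X * W = S - (S \Po - 'X).
  apply: poly_eq_on_nonneg => t _.
  by rewrite !hornerE horner_comp !hornerE WE' SS'.
(* The zero polynomial has the root [0], whose real part is not negative. *)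
have S0 : S != 0.
  apply/eqP => S0; have := dS 0; rewrite S0 /complex_poly raddf0 root0.
  by move=> /(_ isT); rewrite ltxx.
(* ['Re z] lives in [R[i]] and [complex.Re z] in [R]; this links the closed-field lemmas to the
   definitions. *)
have ReE z : 'Re z = (complex.Re z)%:C%C :> R[i] by rewrite complexRe.
have szP : (1 < size (complex_poly S))%N.
  by rewrite size_map_poly; exact: steiner_poly_size cV SV S0.
have Preal : map_poly Num.conj (complex_poly S) = complex_poly S.
  by apply/polyP => i; rewrite !coef_map; exact: conjc_real.
have stP z : root (complex_poly S) z -> 'Re z < 0.
  by move=> /dS; rewrite ReE -(ltcR (complex.Re z) 0).
have PE : 2%:P * 'X * complex_poly W
    = complex_poly S - (complex_poly S \Po - 'X).
  have := congr1 (map_poly (real_complex R)) WE.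
  rewrite !rmorphM rmorphB /= map_polyC map_polyX map_comp_poly rmorphN /=.
  by rewrite map_polyX rmorph_nat.
move=> z Wz; split; last exact: (odd_part_mup _ _ _ Preal szP stP PE).
have := odd_part_root_Re _ _ _ Preal szP stP PE z Wz.
by rewrite ReE => -[].
Qed.
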